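(* Let $\Omega$ be a commutative semigroup and let $(A,( *_{\alpha,\beta})_{\alpha,\beta\in\Omega})$ be an $\Omega$-zinbiel $H$-pseudoalgebra. Define $$x\,\widehat{*}_{\alpha,\beta}\,y=x*_{\alpha,\beta}y+(\sigma\otimes_H\mathrm{id})(y*_{\beta,\alpha}x),\qquad x,y\in A,\ \alpha,\beta\in\Omega.$$ Then $(A,(\widehat{*}_{\alpha,\beta})_{\alpha,\beta\in\Omega})$ is a commutative $\Omega$-associative $H$-pseudoalgebra.
   Context: $k$ is an algebraically closed field of characteristic zero and $H$ is a cocommutative Hopf algebra over $k$ with comultiplication $\Delta$; $\otimes=\otimes_k$. For $n\ge 1$, $H^{\otimes n}$ is a right $H$-module via the iterated comultiplication, and for a left $H$-module $M$ the space $H^{\otimes n}\otimes_H M$ is a left $H^{\otimes n}$-module by left multiplication. A linear map $*: L\otimes M\to H^{\otimes 2}\otimes_H N$ is $H^{\otimes 2}$-linear if $fa*gb=((f\otimes g)\otimes_H 1)(a*b)$ for all $f,g\in H$. Such maps are composed as follows: if $x*y=\sum_i (f_i\otimes g_i)\otimes_H e_i$ and $F\in H^{\otimes 2}$, then $$(F\otimes_H x)*y=\sum_i (F\otimes 1)(\Delta\otimes \mathrm{id})(f_i\otimes g_i)\otimes_H e_i,\qquad x*(F\otimes_H y)=\sum_i (1\otimes F)(\mathrm{id}\otimes\Delta)(f_i\otimes g_i)\otimes_H e_i,$$ elements of $H^{\otimes 3}\otimes_H N$. $\sigma(f\otimes g)=g\otimes f$ is the flip, $(12)(f\otimes g\otimes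 h)=g\otimes f\otimes h$; they act on $H^{\otimes 2}\otimes_H N$, $H^{\otimes 3}\otimes_H N$ as $\sigma\otimes_H\mathrm{id}$, $(12)\otimes_H\mathrm{id}$ (well defined since $H$ is cocommutative). An $\Omega$-zinbiel $H$-pseudoalgebra is a left $H$-module $A$ with an $H^{\otimes 2}$-linear map $*_{\alpha,\beta}:A\otimes A\to H^{\otimes 2}\otimes_H A$ for each $(\alpha,\beta)\in\Omega^2$ such that $x*_{\alpha,\beta\gamma}(y*_{\beta,\gamma}z)=(x*_{\alpha,\beta}y)*_{\alpha\beta,\gamma}z+((12)\otimes_H\mathrm{id})(y*_{\beta,\alpha}x)*_{\alpha\beta,\gamma}z$ for all $x,y,z\in A$, $\alpha,\beta,\gamma\in\Omega$. An $\Omega$-associative $H$-pseudoalgebra is a left $H$-module $A$ with $H^{\otimes 2}$-linear maps $*_{\alpha,\beta}:A\otimes A\to H^{\otimes 2}\otimes_H A$ ($\alpha,\beta\in\Omega$) such that $(a*_{\alpha,\beta}b)*_{\alpha\beta,\gamma}c=a*_{\alpha,\beta\gamma}(b*_{\beta,\gamma}c)$ for all $a,b,c\in A$, $\alpha,\beta,\gamma\in\Omega$; it is commutative if $x*_{\alpha,\beta}y=(\sigma\otimes_H\mathrm{id})(y*_{\beta,\alpha}x)$ for all $x,y\in A$, $\alpha,\beta\in\Omega$. *)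

(* Defs.v *)
From HB Require Import structures.
From mathcomp Require Import all_boot all_order all_algebra.
From mathcomp Require Import ring_quotient boolp classical_sets.
From mathcomp.multinomials Require Import freeg.

Set Implicit Arguments.
Unset Strict Implicit.
Unset Printing Implicit Defensive.

Import GRing.Theory.
Local Open Scope ring_scope.
Local Open Scope quotient_scope.

Section BalancedTensor.
Variables (S : Type) (U V : zmodType) (ract : U -> S -> U) (lact : S -> V -> V).

Inductive tensor_relator : {freeg (U * V)%type} -> Prop :=
| RelatorDl u u' v :
    tensor_relator (<< (u + u', v) >> - << (u, v) >> - << (u', v) >>)
| RelatorDr u v v' :
    tensor_relator (<< (u, v + v') >> - << (u, v) >> - << (u, v') >>)
| RelatorM u s v :
    tensor_relator (<< (ract u s, v) >> - << (u, lact s v) >>).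

(* the subgroup generated by the relators *)
Definition tensor_rel (x : {freeg (U * V)%type}) : bool :=
  `[< forall P : zmodClosed {freeg (U * V)%type},
        (forall r, tensor_relator r -> r \in (P : {pred _})) -> x \in (P : {pred _}) >].

Lemma tensor_rel_zmod_closed : zmod_closed tensor_rel.
Proof.
split=> [|x y /asboolP Px /asboolP Py]; apply/asboolP => P rP.
  exact: rpred0.
by apply: rpredB; [apply: Px | apply: Py].
Qed.

Definition tensor_subgroup : zmodClosed {freeg (U * V)%type} :=
  HB.pack_for (zmodClosed {freeg (U * V)%type}) tensor_rel
    (GRing.isZmodClosed.Build _ tensor_rel tensor_rel_zmod_closed).

Lemma relator_tensor_rel r : tensor_relator r -> r \in tensor_subgroup.
Proof. by move=> rP; apply/asboolP => P; apply. Qed.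

Definition btensor := Quotient.quot tensor_subgroup.
HB.instance Definition _ := GRing.Zmodule.on btensor.

Definition bmk (u : U) (v : V) : btensor := \pi_btensor << (u, v) >>.

Lemma bmkDl u u' v : bmk (u + u') v = bmk u v + bmk u' v.
Proof.
rewrite /bmk -raddfD; apply/eqP; rewrite -Quotient.idealrBE opprD addrA.
exact/relator_tensor_rel/RelatorDl.
Qed.

Lemma bmkDr u v v' : bmk u (v + v') = bmk u v + bmk u v'.
Proof.
rewrite /bmk -raddfD; apply/eqP; rewrite -Quotient.idealrBE opprD addrA.
exact/relator_tensor_rel/RelatorDr.
Qed.

Lemma bmkM u s v : bmk (ract u s) v = bmk u (lact s v).
Proof.
apply/eqP; rewrite -Quotient.idealrBE.
exact/relator_tensor_rel/RelatorM.
Qed.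

Record balanced (W : zmodType) (f : U -> V -> W) : Prop := Balanced {
  balancedDl : forall u u' v, f (u + u') v = f u v + f u' v;
  balancedDr : forall u v v', f u (v + v') = f u v + f u v';
  balancedM : forall u s v, f (ract u s) v = f u (lact s v) }.

Lemma bmk_balanced : balanced bmk.
Proof. by split; [exact: bmkDl | exact: bmkDr | exact: bmkM]. Qed.

(* Total in f, computed on a chosen representative; it is the morphism induced
   by f as soon as f is balanced (blift_bmk, blift_is_additive). *)
Definition blift (W : zmodType) (f : U -> V -> W) (t : btensor) : W :=
  fglift (fun p => f p.1 p.2 : zmodule W) (repr t).

Section Lift.
Variables (W : zmodType) (f : U -> V -> W).
Hypothesis fbal : balanced f.

Let F : {freeg (U * V)%type} -> zmodule W :=
  fglift (fun p => f p.1 p.2 : zmodule W).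

Let FB x y : F (x - y) = F x - F y. Proof. exact: lift_is_additive. Qed.
Let F0 : F 0 = 0. Proof. by rewrite -(subrr 0) FB subrr. Qed.
Let FD x y : F (x + y) = F x + F y.
Proof. by rewrite -{1}[y]opprK FB -sub0r FB F0 sub0r opprK. Qed.
Let FU u v : F << (u, v) >> = f u v.
Proof. by rewrite /F liftU scale1r. Qed.

Let ker_closed : zmod_closed [pred x | F x == 0].
Proof.
split; rewrite ?inE; first by rewrite F0.
by move=> x y; rewrite !inE FB => /eqP-> /eqP->; rewrite subrr.
Qed.
Let Fker := GRing.isZmodClosed.Build _ _ ker_closed.

Let F_rel x : x \in tensor_subgroup -> F x = 0.
Proof.
move=> /asboolP /(_ (HB.pack_for (zmodClosed {freeg (U * V)%type}) (fun x => F x == 0) Fker)) H.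
apply/eqP; apply: H => r [u u' v|u v v'|u s v]; apply/eqP; rewrite !FB !FU.
- by rewrite (balancedDl fbal) -addrA -opprD subrr.
- by rewrite (balancedDr fbal) -addrA -opprD subrr.
- by rewrite (balancedM fbal) subrr.
Qed.

Let bliftE x : blift f (\pi_btensor x) = F x.
Proof.
apply/eqP; rewrite -subr_eq0 -FB; apply/eqP/F_rel.
by rewrite Quotient.idealrBE reprK.
Qed.

Lemma blift_is_additive x y : blift f (x + y) = blift f x + blift f y.
Proof.
elim/quotW: x => x; elim/quotW: y => y.
by rewrite -raddfD !bliftE FD.
Qed.

Lemma blift_bmk u v : blift f (bmk u v) = f u v.
Proof. by rewrite bliftE FU. Qed.

End Lift.

Lemma btensor_ind (P : btensor -> Prop) :
  P 0 -> (forall x y, P x -> P y -> P (x + y)) ->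
  (forall u v, P (bmk u v)) -> forall t, P t.
Proof.
move=> P0 PD Pmk t; elim/quotW: t => x.
have bmk0 v : bmk 0 v = 0.
  by apply: (@addrI _ (bmk 0 v)); rewrite -bmkDl !addr0.
have bmkN u v : bmk (- u) v = - bmk u v.
  by apply/eqP; rewrite -addr_eq0 -bmkDl addNr bmk0.
have -> : \pi_btensor x = \sum_(z <- dom x) \pi_btensor << coeff z x *g z >>.
  by rewrite -[x in LHS]freeg_sumE raddf_sum.
elim/big_ind: _ => //= -[u v] _.
rewrite -[coeff _ _]intz -freegU_mulz raddfMz -/(bmk u v).
have Pn n : P (bmk u v *+ n).
  by elim: n => [|n IH]; rewrite ?mulr0n // mulrS; apply: PD.
have Nn n : P (- bmk u v *+ n).
  by elim: n => [|n IH]; rewrite ?mulr0n // mulrS; apply: PD => //; rewrite -bmkN.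
by case: (coeff _ _) => n; [exact: Pn | rewrite NegzE mulrNz -mulNrz; exact: Nn].
Qed.

Lemma btensor_ext (W : zmodType) (f g : btensor -> W) :
  {morph f : x y / x + y} -> {morph g : x y / x + y} ->
  (forall u v, f (bmk u v) = g (bmk u v)) -> f =1 g.
Proof.
move=> fD gD fg; apply: btensor_ind => [|x y|//]; last first.
  by rewrite fD gD => -> ->.
by apply: (@addrI _ (f 0)); rewrite -fD addr0; apply: (@addIr _ (g 0)); rewrite -addrA -gD !addr0.
Qed.

End BalancedTensor.

Section SeparatingFunctional.
Local Open Scope classical_set_scope.
Variables (k : fieldType) (V : lmodType k) (v : V).
Hypothesis v0 : v != 0.

(* needed only for 1 <> 0 in a tensor product of k-algebras *)
Lemma separating_functional :
  exists f : V -> k, (forall c x y, f (c *: x + y) = c * f x + f y) /\ f v = 1.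
Proof.
pose lin (X : set V) := forall c x y, X x -> X y -> X (c *: x + y).
have [|X [[Xlin Xv] Xmax]] := @Zorn_bigcup V [set X | lin X /\ ~ X v].
  move=> F FP Ftot; split=> [c x y [X FX Xx] [Y FY Yy]|[X FX Xv]]; last first.
    by have [] := FP _ FX.
  have [XY|YX] := Ftot _ _ FX FY.
    by exists Y => //; apply: (FP _ FY).1 => //; exact: XY.
  by exists X => //; apply: (FP _ FX).1 => //; exact: YX.
have X0 : X 0.
  apply: contrapT => nX0.
  have nX x : ~ X x.
    by move=> Xx; apply: nX0; rewrite -(addNr x) -scaleN1r; exact: Xlin.
  apply: (Xmax [set 0]); first by split => [x /nX//|/(_ 0 erefl)].
  split=> [c x y -> ->|/= v0']; first by rewrite scaler0 addr0.
  by move: v0; rewrite v0' eqxx.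
have XZ c x : X x -> X (c *: x) by move=> Xx; rewrite -[_ *: _]addr0; exact: Xlin.
have XD x y : X x -> X y -> X (x + y).
  by move=> Xx Xy; rewrite -[x]scale1r; exact: Xlin.
have ex x : exists c, X (x - c *: v).
  have [Xx|nXx] := pselect (X x); first by exists 0; rewrite scale0r subr0.
  pose B := [set y | exists a c, X a /\ y = a + c *: x].
  have Blin : lin B.
    move=> c _ _ [a [d [Xa ->]]] [a' [d' [Xa' ->]]].
    exists (c *: a + a'), (c * d + d'); split; first exact: Xlin.
    by rewrite scalerDr scalerDl scalerA addrACA.
  have Bv : B v.
    apply: contrapT => nBv; apply: (Xmax B) => //; split.
      by move=> y Xy; exists y, 0; rewrite scale0r addr0.
    by move=> /(_ x) BX; apply/nXx/BX; exists 0, 1; rewrite scale1r add0r.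
  have [a [c [Xa vE]]] := Bv.
  have c0 : c != 0.
    by apply/eqP => c0; apply: Xv; rewrite vE c0 scale0r addr0.
  exists c^-1; have -> : x - c^-1 *: v = - c^-1 *: a.
    rewrite vE scalerDr scalerA mulVf // scale1r opprD addrCA subrr addr0.
    by rewrite scaleNr.
  exact: XZ.
have uniq x c d : X (x - c *: v) -> X (x - d *: v) -> c = d.
  move=> Xc Xd; apply/eqP; rewrite -subr_eq0; apply: contrapT => /negP cd.
  apply: Xv; rewrite -[v]scale1r -(mulVf cd) -scalerA; apply: (XZ).
  have -> : (c - d) *: v = (x - d *: v) + (-1) *: (x - c *: v).
    by rewrite scaleN1r opprB [RHS]addrC addrA subrK scalerBl.
  by apply: XD => //; exact: XZ.
pose f x := projT1 (cid (ex x)); have fP x : X (x - f x *: v) by rewrite /f; case: cid.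
exists f; split => [c x y|].
  apply: (uniq (c *: x + y)) => //; rewrite scalerDl opprD addrACA -scalerA -scalerBr.
  exact: Xlin.
by apply: (uniq v) => //; rewrite scale1r subrr.
Qed.

End SeparatingFunctional.

Section Tensor.
Variables (k : fieldType) (U V : lmodType k).

Definition tensor := btensor (fun (u : U) (c : k) => c *: u) (fun c (v : V) => c *: v).
HB.instance Definition _ := GRing.Zmodule.on tensor.

Definition tmk (u : U) (v : V) : tensor := bmk _ _ u v.

Definition tlift (W : zmodType) (f : U -> V -> W) (t : tensor) : W := blift f t.

Definition tbalanced (W : zmodType) (f : U -> V -> W) :=
  balanced (fun (u : U) (c : k) => c *: u) (fun c (v : V) => c *: v) f.

Lemma tmk_balanced : tbalanced tmk. Proof. exact: bmk_balanced. Qed.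
Definition tmkDl := balancedDl tmk_balanced.
Definition tmkDr := balancedDr tmk_balanced.
Definition tmkZ := balancedM tmk_balanced.

Lemma tlift_tmk (W : zmodType) (f : U -> V -> W) u v : tbalanced f -> tlift f (tmk u v) = f u v.
Proof. by move=> fbal; exact: (blift_bmk fbal). Qed.

Lemma tliftD (W : zmodType) (f : U -> V -> W) x y :
  tbalanced f -> tlift f (x + y) = tlift f x + tlift f y.
Proof. by move=> fbal; exact: (blift_is_additive fbal). Qed.

Lemma tensor_ext (W : zmodType) (f g : tensor -> W) :
  {morph f : x y / x + y} -> {morph g : x y / x + y} ->
  (forall u v, f (tmk u v) = g (tmk u v)) -> f =1 g.
Proof. exact: btensor_ext. Qed.

Definition tscale (c : k) : tensor -> tensor := tlift (fun u v => tmk (c *: u) v).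

Let tscale_bal c : tbalanced (fun u v => tmk (c *: u) v).
Proof.
split=> [u u' v|u v v'|u d v]; first by rewrite scalerDr tmkDl.
  by rewrite tmkDr.
by rewrite scalerA mulrC -scalerA tmkZ.
Qed.

Lemma tscale_tmk c u v : tscale c (tmk u v) = tmk (c *: u) v.
Proof. exact: tlift_tmk. Qed.

Let tscaleDr c : {morph tscale c : x y / x + y}.
Proof. by move=> x y; exact: tliftD. Qed.

Let tscaleA c d t : tscale c (tscale d t) = tscale (c * d) t.
Proof.
move: t; apply: tensor_ext => [x y|x y|u v]; rewrite ?tscaleDr //.
by rewrite !tscale_tmk scalerA.
Qed.

Let tscale1 : left_id 1 tscale.
Proof.
by apply: tensor_ext => [x y|x y|u v]; rewrite ?tscaleDr // tscale_tmk scale1r.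
Qed.

Let tscaleDl t : {morph tscale^~ t : c d / c + d}.
Proof.
move=> c d; move: t; apply: tensor_ext => [x y|x y|u v].
- by rewrite tscaleDr.
- by rewrite !tscaleDr addrACA.
- by rewrite !tscale_tmk scalerDl tmkDl.
Qed.

HB.instance Definition _ := GRing.Zmodule_isLmodule.Build k tensor
  tscaleA tscale1 tscaleDr tscaleDl.

Lemma tmkZl c u v : tmk (c *: u) v = c *: tmk u v.
Proof. by rewrite -tscale_tmk. Qed.

Lemma tmkZr c u v : tmk u (c *: v) = c *: tmk u v.
Proof. by rewrite -tmkZ tmkZl. Qed.

End Tensor.

Arguments tensor {k} (U V)%_type.
Notation "U ⊗ V" := (tensor U V) (at level 40, left associativity) : type_scope.
Notation "u ⊗ v" := (tmk u v) (at level 40, left associativity) : ring_scope.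

Section TensorMaps.
Variable k : fieldType.

Definition tmap (U V U' V' : lmodType k) (f : U -> U') (g : V -> V') :
  U ⊗ V -> U' ⊗ V' := tlift (fun u v => f u ⊗ g v).

Definition tflip (U V : lmodType k) : U ⊗ V -> V ⊗ U := tlift (fun u v => v ⊗ u).

Definition tassoc (U V W : lmodType k) : U ⊗ (V ⊗ W) -> U ⊗ V ⊗ W :=
  tlift (fun u => tlift (fun v w => u ⊗ v ⊗ w)).

Lemma tmap_balanced (U V U' V' : lmodType k) (f : {linear U -> U'}) (g : {linear V -> V'}) :
  tbalanced (fun u v => f u ⊗ g v).
Proof.
split=> [u u' v|u v v'|u c v]; first by rewrite linearD tmkDl.
  by rewrite linearD tmkDr.
by rewrite !linearZ /= tmkZl tmkZr.
Qed.

Lemma tmapE (U V U' V' : lmodType k) (f : {linear U -> U'}) (g : {linear V -> V'}) u v :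
  tmap f g (u ⊗ v) = f u ⊗ g v.
Proof. exact: tlift_tmk (tmap_balanced f g). Qed.

Lemma tflip_balanced (U V : lmodType k) : tbalanced (fun (u : U) (v : V) => v ⊗ u).
Proof.
by split=> *; rewrite ?tmkDl ?tmkDr ?tmkZ.
Qed.

Lemma tflipE (U V : lmodType k) (u : U) (v : V) : tflip (u ⊗ v) = v ⊗ u.
Proof. exact: tlift_tmk (tflip_balanced U V). Qed.

Lemma tassoc1_balanced (U V W : lmodType k) (u : U) :
  tbalanced (fun (v : V) (w : W) => u ⊗ v ⊗ w).
Proof. by split=> *; rewrite ?tmkDr ?tmkDl // tmkZr tmkZ. Qed.

Lemma tassoc_balanced (U V W : lmodType k) :
  tbalanced (fun (u : U) => tlift (fun (v : V) (w : W) => u ⊗ v ⊗ w)).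
Proof.
split=> [u u'|u x y|u c].
- apply: tensor_ext => [x y|x y|v w].
  + exact: (tliftD _ _ (tassoc1_balanced _ _ _)).
  + by rewrite !(tliftD _ _ (tassoc1_balanced _ _ _)) addrACA.
  by rewrite !(tlift_tmk _ _ (tassoc1_balanced _ _ _)) !tmkDl.
- exact: (tliftD _ _ (tassoc1_balanced _ _ _)).
- apply: tensor_ext => [x y|x y|v w].
  + exact: (tliftD _ _ (tassoc1_balanced _ _ _)).
  + by rewrite scalerDr (tliftD _ _ (tassoc1_balanced _ _ _)).
  + by rewrite -tmkZl !(tlift_tmk _ _ (tassoc1_balanced _ _ _)) tmkZ.
Qed.

Lemma tassocE (U V W : lmodType k) (u : U) (v : V) (w : W) :
  tassoc (u ⊗ (v ⊗ w)) = u ⊗ v ⊗ w.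
Proof.
rewrite /tassoc (tlift_tmk _ _ (tassoc_balanced _ _ _)).
exact: (tlift_tmk _ _ (tassoc1_balanced _ _ _)).
Qed.

End TensorMaps.

Section TensorAlgebra.
Variables (k : fieldType) (A B : algType k).

Definition tmul (s t : A ⊗ B) : A ⊗ B :=
  tlift (fun a b => tlift (fun a' b' => (a * a') ⊗ (b * b')) t) s.

Let bal1 (a : A) (b : B) : tbalanced (fun a' b' => (a * a') ⊗ (b * b')).
Proof.
split=> [u u' v|u v v'|u c v]; first by rewrite mulrDr tmkDl.
  by rewrite mulrDr tmkDr.
by rewrite -!scalerAr tmkZl tmkZr.
Qed.

Let bal2 (t : A ⊗ B) : tbalanced (fun a b => tlift (fun a' b' => (a * a') ⊗ (b * b')) t).
Proof.
split=> [u u' v|u v v'|u c v]; move: t.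
- apply: tensor_ext => [x y|x y|a b]; rewrite ?(tliftD _ _ (bal1 _ _)) //.
    by rewrite addrACA.
  by rewrite !(tlift_tmk _ _ (bal1 _ _)) mulrDl tmkDl.
- apply: tensor_ext => [x y|x y|a b]; rewrite ?(tliftD _ _ (bal1 _ _)) //.
    by rewrite addrACA.
  by rewrite !(tlift_tmk _ _ (bal1 _ _)) mulrDl tmkDr.
- apply: tensor_ext => [x y|x y|a b]; rewrite ?(tliftD _ _ (bal1 _ _)) //.
  by rewrite !(tlift_tmk _ _ (bal1 _ _)) -!scalerAl tmkZl tmkZr.
Qed.

Let tmulE a b a' b' : tmul (a ⊗ b) (a' ⊗ b') = (a * a') ⊗ (b * b').
Proof. by rewrite /tmul (tlift_tmk _ _ (bal2 _)) (tlift_tmk _ _ (bal1 _ _)). Qed.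

Let tmulDl : left_distributive tmul +%R.
Proof. by move=> x y z; exact: tliftD. Qed.

Let tmulDr : right_distributive tmul +%R.
Proof.
move=> s x y; move: s; apply: tensor_ext => [s t|s t|a b]; rewrite ?tmulDl //.
  by rewrite addrACA.
by rewrite /tmul !(tlift_tmk _ _ (bal2 _)) (tliftD _ _ (bal1 _ _)).
Qed.

Let tmulA : associative tmul.
Proof.
move=> x y z; move: x; apply: tensor_ext => [s t|s t|a b]; rewrite ?tmulDl //.
move: y; apply: tensor_ext => [s t|s t|a' b']; rewrite ?(tmulDl, tmulDr) //.
move: z; apply: tensor_ext => [s t|s t|a'' b'']; rewrite ?(tmulDl, tmulDr) //.
by rewrite !tmulE !mulrA.
Qed.

Let tmul1l : left_id (1 ⊗ 1) tmul.
Proof.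
by apply: tensor_ext => [s t|s t|a b]; rewrite ?tmulDr // tmulE !mul1r.
Qed.

Let tmul1r : right_id (1 ⊗ 1) tmul.
Proof.
by apply: tensor_ext => [s t|s t|a b]; rewrite ?tmulDl // tmulE !mulr1.
Qed.

Let tone_neq0 : (1 : A) ⊗ (1 : B) != 0.
Proof.
have [f [flin f1]] := separating_functional (oner_neq0 A).
have [g [glin g1]] := separating_functional (oner_neq0 B).
have fD u v : f (u + v) = f u + f v by rewrite -{1}[u]scale1r flin mul1r.
have gD u v : g (u + v) = g u + g v by rewrite -{1}[u]scale1r glin mul1r.
have f0 : f 0 = 0 by apply: (@addrI _ (f 0)); rewrite -fD !addr0.
have g0 : g 0 = 0 by apply: (@addrI _ (g 0)); rewrite -gD !addr0.
have fg : tbalanced (fun u v => f u * g v).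
  split=> [u u' v|u v v'|u c v]; first by rewrite fD mulrDl.
    by rewrite gD mulrDr.
  by rewrite -[c *: u]addr0 flin f0 addr0 -[c *: v]addr0 glin g0 addr0 mulrCA mulrA.
have fg0 : tlift (fun u v => f u * g v) 0 = 0.
  by apply: (@addrI _ (tlift (fun u v => f u * g v) 0)); rewrite -(tliftD _ _ fg) !addr0.
apply/eqP => E; have := tlift_tmk 1 1 fg; rewrite E fg0 f1 g1 mulr1 => /esym/eqP.
by rewrite oner_eq0.
Qed.

HB.instance Definition _ := GRing.Zmodule_isNzRing.Build (A ⊗ B)%type
  tmulA tmul1l tmul1r tmulDl tmulDr tone_neq0.

Lemma tmulrE (a a' : A) (b b' : B) : (a ⊗ b) * (a' ⊗ b') = (a * a') ⊗ (b * b').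
Proof. exact: tmulE. Qed.

Lemma toneE : 1 = (1 : A) ⊗ (1 : B). Proof. by []. Qed.

Let tscaleAl (c : k) (x y : A ⊗ B) : c *: (x * y) = (c *: x) * y.
Proof.
move: x; apply: tensor_ext => [s t|s t|a b]; rewrite ?(mulrDl, scalerDr) ?mulrDl //.
move: y; apply: tensor_ext => [s t|s t|a' b']; rewrite ?(mulrDr, scalerDr) //.
by rewrite -tmkZl !tmulrE -scalerAl tmkZl.
Qed.

HB.instance Definition _ := GRing.Lmodule_isLalgebra.Build k (A ⊗ B)%type tscaleAl.

Let tscaleAr (c : k) (x y : A ⊗ B) : c *: (x * y) = x * (c *: y).
Proof.
move: x; apply: tensor_ext => [s t|s t|a b]; rewrite ?(mulrDl, scalerDr) ?mulrDl //.
move: y; apply: tensor_ext => [s t|s t|a' b']; rewrite ?(mulrDr, scalerDr) ?mulrDr //.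
by rewrite -tmkZl !tmulrE -scalerAr tmkZl.
Qed.

HB.instance Definition _ := GRing.Lalgebra_isAlgebra.Build k (A ⊗ B)%type tscaleAr.

End TensorAlgebra.

(* For a ring morphism d : H -> B, the ring B is a right H-module through
   b . h = b * d h, and hten d M is B ⊗_H M with its left B-module structure. *)
Section ExtensionOfScalars.
Variables (H B : pzRingType) (d : H -> B) (M : lmodType H).

Definition hten := btensor (fun (b : B) (h : H) => b * d h) (fun h (m : M) => h *: m).
HB.instance Definition _ := GRing.Zmodule.on hten.

Definition hmk (b : B) (m : M) : hten := bmk _ _ b m.

Definition hlift (W : zmodType) (f : B -> M -> W) (t : hten) : W := blift f t.

Definition hbalanced (W : zmodType) (f : B -> M -> W) :=
  balanced (fun (b : B) (h : H) => b * d h) (fun h (m : M) => h *: m) f.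

Lemma hmk_balanced : hbalanced hmk. Proof. exact: bmk_balanced. Qed.
Definition hmkDl := balancedDl hmk_balanced.
Definition hmkDr := balancedDr hmk_balanced.
Definition hmkM := balancedM hmk_balanced.

Lemma hlift_hmk (W : zmodType) (f : B -> M -> W) b m : hbalanced f -> hlift f (hmk b m) = f b m.
Proof. by move=> fbal; exact: (blift_bmk fbal). Qed.

Lemma hliftD (W : zmodType) (f : B -> M -> W) x y :
  hbalanced f -> hlift f (x + y) = hlift f x + hlift f y.
Proof. by move=> fbal; exact: (blift_is_additive fbal). Qed.

Lemma hten_ext (W : zmodType) (f g : hten -> W) :
  {morph f : x y / x + y} -> {morph g : x y / x + y} ->
  (forall b m, f (hmk b m) = g (hmk b m)) -> f =1 g.
Proof. exact: btensor_ext. Qed.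

Definition hscale (c : B) : hten -> hten := hlift (fun b m => hmk (c * b) m).

Let hscale_bal c : hbalanced (fun b m => hmk (c * b) m).
Proof.
split=> [u u' v|u v v'|u h v]; first by rewrite mulrDr hmkDl.
  by rewrite hmkDr.
by rewrite mulrA hmkM.
Qed.

Let hscale_hmk c b m : hscale c (hmk b m) = hmk (c * b) m.
Proof. exact: (hlift_hmk _ _ (hscale_bal c)). Qed.

Let hscaleDr c : {morph hscale c : x y / x + y}.
Proof. by move=> x y; exact: (hliftD _ _ (hscale_bal c)). Qed.

Let hscaleA c c' t : hscale c (hscale c' t) = hscale (c * c') t.
Proof.
move: t; apply: hten_ext => [x y|x y|b m]; rewrite ?hscaleDr //.
by rewrite !hscale_hmk mulrA.
Qed.

Let hscale1 : left_id 1 hscale.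
Proof.
by apply: hten_ext => [x y|x y|b m]; rewrite ?hscaleDr // hscale_hmk mul1r.
Qed.

Let hscaleDl t : {morph hscale^~ t : c c' / c + c'}.
Proof.
move=> c c'; move: t; apply: hten_ext => [x y|x y|b m].
- by rewrite hscaleDr.
- by rewrite !hscaleDr addrACA.
- by rewrite !hscale_hmk mulrDl hmkDl.
Qed.

HB.instance Definition _ := GRing.Zmodule_isLmodule.Build B hten
  hscaleA hscale1 hscaleDr hscaleDl.

Lemma scale_hmk c b m : c *: hmk b m = hmk (c * b) m.
Proof. exact: hscale_hmk. Qed.

End ExtensionOfScalars.

Structure hopfAlgType (k : fieldType) := HopfAlgType {
  hopf_sort :> algType k;
  comul : {lrmorphism hopf_sort -> (hopf_sort ⊗ hopf_sort)%type};
  counit : {lrmorphism hopf_sort -> k^o};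
  antipode : {linear hopf_sort -> hopf_sort};
  comulA : forall h, tassoc (tmap idfun comul (comul h)) = tmap comul idfun (comul h);
  counitl : forall h, tlift (fun x y => counit x *: y) (comul h) = h;
  counitr : forall h, tlift (fun x y => counit y *: x) (comul h) = h;
  antipodel : forall h, tlift (fun x y => antipode x * y) (comul h) = (counit h)%:A;
  antipoder : forall h, tlift (fun x y => x * antipode y) (comul h) = (counit h)%:A
}.
Arguments comul {k h} : rename.
Arguments counit {k h} : rename.
Arguments antipode {k h} : rename.

Definition cocommutative (k : fieldType) (H : hopfAlgType k) :=
  forall h : H, tflip (comul h) = comul h.

Section TensorAlgebraMaps.
Variable k : fieldType.

Lemma tmapD (U V U' V' : lmodType k) (f : {linear U -> U'}) (g : {linear V -> V'}) :
  forall x y, tmap f g (x + y) = tmap f g x + tmap f g y.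
Proof. by move=> x y; exact: (tliftD _ _ (tmap_balanced f g)). Qed.

Lemma tflipD (U V : lmodType k) (x y : U ⊗ V) : tflip (x + y) = tflip x + tflip y.
Proof. exact: (tliftD _ _ (tflip_balanced U V)). Qed.

Lemma tassocD (U V W : lmodType k) (x y : U ⊗ (V ⊗ W)) :
  tassoc (x + y) = tassoc x + tassoc y.
Proof. exact: (tliftD _ _ (tassoc_balanced U V W)). Qed.

Lemma tmapM (A B A' B' : algType k) (f : {lrmorphism A -> A'}) (g : {lrmorphism B -> B'}) :
  forall x y, tmap f g (x * y) = tmap f g x * tmap f g y.
Proof.
move=> x y; move: x; apply: tensor_ext => [s t|s t|a b].
- by rewrite mulrDl tmapD.
- by rewrite tmapD mulrDl.
move: y; apply: tensor_ext => [s t|s t|a' b'].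
- by rewrite mulrDr tmapD.
- by rewrite tmapD mulrDr.
by rewrite tmulrE !tmapE tmulrE !rmorphM.
Qed.

Lemma tflipM (A B : algType k) (x y : A ⊗ B) : tflip (x * y) = tflip x * tflip y.
Proof.
move: x; apply: tensor_ext => [s t|s t|a b].
- by rewrite mulrDl tflipD.
- by rewrite tflipD mulrDl.
move: y; apply: tensor_ext => [s t|s t|a' b'].
- by rewrite mulrDr tflipD.
- by rewrite tflipD mulrDr.
by rewrite tmulrE !tflipE tmulrE.
Qed.

Lemma tassocM (A B C : algType k) (x y : A ⊗ (B ⊗ C)) :
  tassoc (x * y) = tassoc x * tassoc y.
Proof.
move: x; apply: tensor_ext => [s t|s t|a z].
- by rewrite mulrDl tassocD.
- by rewrite tassocD mulrDl.
move: z; apply: tensor_ext => [s t|s t|b c].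
- by rewrite tmkDr mulrDl tassocD.
- by rewrite tmkDr tassocD mulrDl.
move: y; apply: tensor_ext => [s t|s t|a' z'].
- by rewrite mulrDr tassocD.
- by rewrite tassocD mulrDr.
move: z'; apply: tensor_ext => [s t|s t|b' c'].
- by rewrite tmkDr mulrDr !tassocD.
- by rewrite tmkDr tassocD mulrDr.
by rewrite tmulrE tmulrE !tassocE !tmulrE.
Qed.

Lemma tflipZ (U V : lmodType k) c (x : U ⊗ V) : tflip (c *: x) = c *: tflip x.
Proof.
move: x; apply: tensor_ext => [s t|s t|u v].
- by rewrite scalerDr tflipD.
- by rewrite tflipD scalerDr.
by rewrite -tmkZl !tflipE tmkZr.
Qed.

Lemma tflip_is_linear (U V : lmodType k) : linear (@tflip k U V).
Proof. by move=> c x y; rewrite tflipD tflipZ. Qed.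

HB.instance Definition _ (U V : lmodType k) :=
  GRing.isLinear.Build k (U ⊗ V)%type (V ⊗ U)%type _ (@tflip k U V)
    (@tflip_is_linear U V).

Lemma tflip_is_monoid_morphism (A B : algType k) : monoid_morphism (@tflip k A B).
Proof. by split=> [|x y]; rewrite ?toneE ?tflipE ?tflipM. Qed.

HB.instance Definition _ (A B : algType k) :=
  GRing.isMonoidMorphism.Build (A ⊗ B)%type (B ⊗ A)%type (@tflip k A B)
    (@tflip_is_monoid_morphism A B).

End TensorAlgebraMaps.

Section PseudoOperations.
Variables (k : fieldType) (H : hopfAlgType k).

Definition comul3 (h : H) : (H ⊗ H ⊗ H)%type := tmap comul idfun (comul h).

(* H^{⊗2} ⊗_H M and H^{⊗3} ⊗_H M, for the right H-module structures given by
   the iterated comultiplications Δ and (Δ ⊗ id) Δ *)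
Definition pten2 (M : lmodType H) := hten (comul : H -> (H ⊗ H)%type) M.
Definition pten3 (M : lmodType H) := hten comul3 M.
HB.instance Definition _ M := GRing.Lmodule.on (pten2 M).
HB.instance Definition _ M := GRing.Lmodule.on (pten3 M).

(* A module over a k-algebra is a k-vector space through c%:A. *)
Definition klinear (A B : algType k) (L : lmodType A) (N : lmodType B) (f : L -> N) :=
  forall (c : k) (u v : L), f ((c%:A : A) *: u + v) = (c%:A : B) *: f u + f v.

(* A linear map * on L ⊗ M is given by the k-bilinear map op x y = x * y. *)
Record pseudolinear (L M N : lmodType H) (op : L -> M -> pten2 N) : Prop :=
  Pseudolinear {
    pseudo_linearl : forall y, klinear (fun x => op x y);
    pseudo_linearr : forall x, klinear (op x);
    pseudoM : forall f g a b, op (f *: a) (g *: b) = (f ⊗ g) *: op a b }.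

(* t * y and x * t for t = F ⊗_H _; the sum over i of (f_i ⊗ g_i) ⊗_H e_i = x * y
   is the inner hlift. As id ⊗ Δ takes values in H ⊗ (H ⊗ H), the product there
   is moved to (H ⊗ H) ⊗ H by tassoc. *)
Definition pcompl (L M N : lmodType H) (op : L -> M -> pten2 N)
    (t : pten2 L) (y : M) : pten3 N :=
  hlift (fun F x =>
    hlift (fun G e => hmk comul3 ((F ⊗ 1) * tmap comul idfun G) e) (op x y)) t.

Definition pcompr (L M N : lmodType H) (op : L -> M -> pten2 N)
    (x : L) (t : pten2 M) : pten3 N :=
  hlift (fun F y =>
    hlift (fun G e => hmk comul3 (tassoc ((1 ⊗ F) * tmap idfun comul G)) e) (op x y)) t.

(* σ ⊗_H id and (12) ⊗_H id *)
Definition psigma (M : lmodType H) (t : pten2 M) : pten2 M :=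
  hlift (fun F e => hmk comul (tflip F) e) t.

Definition pperm12 (M : lmodType H) (t : pten3 M) : pten3 M :=
  hlift (fun F e => hmk comul3 (tmap (@tflip k H H) idfun F) e) t.

Lemma psigma_balanced (M : lmodType H) : cocommutative H ->
  hbalanced comul (fun F (e : M) => hmk comul (tflip F) e).
Proof.
move=> comulC; split=> [u u' v|u v v'|u h v]; first by rewrite tflipD hmkDl.
  by rewrite hmkDr.
by rewrite tflipM comulC hmkM.
Qed.

Lemma psigmaE (M : lmodType H) F (e : M) : cocommutative H -> psigma (hmk comul F e) = hmk comul (tflip F) e.
Proof. by move=> comulC; exact: (hlift_hmk _ _ (psigma_balanced M comulC)). Qed.


Lemma hcomul3M (G : (H ⊗ H)%type) h :
  tmap comul idfun (G * comul h) = tmap comul idfun G * comul3 h.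
Proof. exact: tmapM. Qed.

Lemma pperm12_balanced (M : lmodType H) : cocommutative H ->
  hbalanced comul3 (fun F (e : M) => hmk comul3 (tmap (@tflip k H H) idfun F) e).
Proof.
move=> comulC; have flipC h : tmap (@tflip k H H) idfun (comul3 h) = comul3 h.
  rewrite /comul3; move: (comul h); apply: tensor_ext => [x y|x y|u v].
  - by rewrite !tmapD.
  - by rewrite tmapD.
  by rewrite !tmapE /= comulC.
split=> [u u' v|u v v'|u h v]; first by rewrite tmapD hmkDl.
  by rewrite hmkDr.
by rewrite tmapM flipC hmkM.
Qed.

Lemma pperm12E (M : lmodType H) F (e : M) : cocommutative H ->
  pperm12 (hmk comul3 F e) = hmk comul3 (tmap (@tflip k H H) idfun F) e.
Proof. by move=> comulC; exact: (hlift_hmk _ _ (pperm12_balanced M comulC)). Qed.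

Lemma pcompl1_balanced (N : lmodType H) (F : (H ⊗ H)%type) :
  hbalanced comul (fun G (e : N) => hmk comul3 ((F ⊗ 1) * tmap comul idfun G) e).
Proof.
split=> [u u' v|u v v'|u h v]; first by rewrite tmapD mulrDr hmkDl.
  by rewrite hmkDr.
by rewrite hcomul3M mulrA hmkM.
Qed.

Lemma pcompr1_balanced (N : lmodType H) (F : (H ⊗ H)%type) :
  hbalanced comul
    (fun G (e : N) => hmk comul3 (tassoc ((1 ⊗ F) * tmap idfun comul G)) e).
Proof.
split=> [u u' v|u v v'|u h v]; first by rewrite tmapD mulrDr tassocD hmkDl.
  by rewrite hmkDr.
by rewrite tmapM mulrA tassocM comulA hmkM.
Qed.

Section Composition.
Variables (L M N : lmodType H) (op : L -> M -> pten2 N).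
Hypothesis opP : pseudolinear op.

Let opDl x x' y : op (x + x') y = op x y + op x' y.
Proof. by have := pseudo_linearl opP y 1 x x'; rewrite !scale1r. Qed.

Let opDr x y y' : op x (y + y') = op x y + op x y'.
Proof. by have := pseudo_linearr opP x 1 y y'; rewrite !scale1r. Qed.

Let opZl h x y : op (h *: x) y = (h ⊗ 1) *: op x y.
Proof. by rewrite -{1}[y]scale1r (pseudoM opP). Qed.

Let opZr h x y : op x (h *: y) = (1 ⊗ h) *: op x y.
Proof. by rewrite -{1}[x]scale1r (pseudoM opP). Qed.

Lemma pcompl_balanced (y : M) :
  hbalanced comul (fun F x =>
    hlift (fun G e => hmk comul3 ((F ⊗ 1) * tmap comul idfun G) e) (op x y)).
Proof.
split=> [F F' x|F x x'|F h x].
- move: (op x y); apply: hten_ext => [s t|s t|b m].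
  + by rewrite !(hliftD _ _ (pcompl1_balanced _ _)).
  + by rewrite !(hliftD _ _ (pcompl1_balanced _ _)) addrACA.
  by rewrite !(hlift_hmk _ _ (pcompl1_balanced _ _)) tmkDl mulrDl hmkDl.
- by rewrite opDl (hliftD _ _ (pcompl1_balanced _ _)).
- rewrite opZl; move: (op x y); apply: hten_ext => [s t|s t|b m].
  + by rewrite !(hliftD _ _ (pcompl1_balanced _ _)).
  + by rewrite scalerDr !(hliftD _ _ (pcompl1_balanced _ _)).
  rewrite scale_hmk !(hlift_hmk _ _ (pcompl1_balanced _ _)).
  by rewrite tmapM tmapE mulrA tmulrE mulr1.
Qed.

Lemma pcompr_balanced (x : L) :
  hbalanced comul (fun F y =>
    hlift (fun G e => hmk comul3 (tassoc ((1 ⊗ F) * tmap idfun comul G)) e) (op x y)).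
Proof.
split=> [F F' y|F y y'|F h y].
- move: (op x y); apply: hten_ext => [s t|s t|b m].
  + by rewrite !(hliftD _ _ (pcompr1_balanced _ _)).
  + by rewrite !(hliftD _ _ (pcompr1_balanced _ _)) addrACA.
  by rewrite !(hlift_hmk _ _ (pcompr1_balanced _ _)) tmkDr mulrDl tassocD hmkDl.
- by rewrite opDr (hliftD _ _ (pcompr1_balanced _ _)).
- rewrite opZr; move: (op x y); apply: hten_ext => [s t|s t|b m].
  + by rewrite !(hliftD _ _ (pcompr1_balanced _ _)).
  + by rewrite scalerDr !(hliftD _ _ (pcompr1_balanced _ _)).
  rewrite scale_hmk !(hlift_hmk _ _ (pcompr1_balanced _ _)).
  by rewrite tmapM tmapE mulrA tmulrE mulr1.
Qed.

Lemma pcomplE F x y :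
  pcompl op (hmk comul F x) y =
  hlift (fun G e => hmk comul3 ((F ⊗ 1) * tmap comul idfun G) e) (op x y).
Proof. exact: (hlift_hmk _ _ (pcompl_balanced y)). Qed.

Lemma pcomprE F x y :
  pcompr op x (hmk comul F y) =
  hlift (fun G e => hmk comul3 (tassoc ((1 ⊗ F) * tmap idfun comul G)) e) (op x y).
Proof. exact: (hlift_hmk _ _ (pcompr_balanced x)). Qed.

End Composition.

End PseudoOperations.

Section OmegaPseudoalgebras.
Variables (k : fieldType) (H : hopfAlgType k) (Om : Type) (mul : Om -> Om -> Om).
Variable A : lmodType H.
Implicit Type op : Om -> Om -> A -> A -> pten2 A.

Record zinbiel_pseudoalgebra op : Prop := ZinbielPseudoalgebra {
  zinbiel_pseudolinear : forall a b, pseudolinear (op a b);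
  zinbielE : forall x y z a b c,
    pcompr (op a (mul b c)) x (op b c y z) =
    pcompl (op (mul a b) c) (op a b x y) z
    + pperm12 (pcompl (op (mul a b) c) (op b a y x) z) }.

Record assoc_pseudoalgebra op : Prop := AssocPseudoalgebra {
  assoc_pseudolinear : forall a b, pseudolinear (op a b);
  assocE : forall x y z a b c,
    pcompl (op (mul a b) c) (op a b x y) z = pcompr (op a (mul b c)) x (op b c y z) }.

Definition commutative_pseudo op :=
  forall x y a b, op a b x y = psigma (op b a y x).

Definition zinbiel_hat op : Om -> Om -> A -> A -> pten2 A :=
  fun a b x y => op a b x y + psigma (op b a y x).

End OmegaPseudoalgebras.

(* Main.v *)
(* By cocommutativity the symmetric group S_3 acts on H^{⊗3} ⊗_H A, and
   (σ t) * y = (12)(t * y).  The zinbiel identity therefore reads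
   x * (y * z) = (x ^* y) * z, whose right-hand side is invariant under exchanging
   x and y and applying (12); hence x * (y * z) = (12)(y * (x * z)).  Expanding
   both sides of the associativity of ^* with this, each becomes
   x * (y * z) + (23)(x * (z * y)) + (f ⊗ g ⊗ h |-> h ⊗ f ⊗ g)(y * (z * x)). *)
Require Import Defs.
From mathcomp Require Import all_boot all_order all_algebra.

Set Implicit Arguments.
Unset Strict Implicit.
Unset Printing Implicit Defensive.

Import GRing.Theory.
Local Open Scope ring_scope.

(** * Rotation and flips of threefold tensor products *)

Section TripleTensors.
Variable k : fieldType.

Lemma tensor3_ext (U V X : lmodType k) (W : zmodType)
    (f g : ((U ⊗ V) ⊗ X)%type -> W) :
  {morph f : x y / x + y} -> {morph g : x y / x + y} ->
  (forall u v x, f (u ⊗ v ⊗ x) = g (u ⊗ v ⊗ x)) -> f =1 g.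
Proof.
move=> fD gD fg; apply: tensor_ext => // s x; move: s.
by apply: tensor_ext => [s t|s t|u v //]; rewrite tmkDl ?fD ?gD.
Qed.

Lemma tensor3_extr (U V X : lmodType k) (W : zmodType)
    (f g : (U ⊗ (V ⊗ X))%type -> W) :
  {morph f : x y / x + y} -> {morph g : x y / x + y} ->
  (forall u v x, f (u ⊗ (v ⊗ x)) = g (u ⊗ (v ⊗ x))) -> f =1 g.
Proof.
move=> fD gD fg; apply: tensor_ext => // u s; move: s.
by apply: tensor_ext => [s t|s t|v x //]; rewrite tmkDr ?fD ?gD.
Qed.

Lemma tflipK (U V : lmodType k) (x : (U ⊗ V)%type) : tflip (tflip x) = x.
Proof. by move: x; apply: tensor_ext => [x y|x y|u v]; rewrite ?tflipD ?tflipE. Qed.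

Lemma tflip_tmap (U V U' V' : lmodType k) (f : {linear U -> U'})
    (g : {linear V -> V'}) x :
  tflip (tmap f g x) = tmap g f (tflip x).
Proof.
by move: x; apply: tensor_ext => [x y|x y|u v]; rewrite ?(tmapD, tflipD, tmapE, tflipE).
Qed.

(** The 3-cycle, factored as an outer flip followed by reassociation: multiplicativity is then
    inherited from both factors, and coassociativity applies directly. *)
Definition trot (U V X : lmodType k) (t : ((U ⊗ V) ⊗ X)%type) : ((X ⊗ U) ⊗ V)%type :=
  tassoc (tflip t).

Lemma trotD (U V X : lmodType k) : {morph @trot U V X : x y / x + y}.
Proof. by move=> x y; rewrite /trot tflipD tassocD. Qed.

Lemma trotE (U V X : lmodType k) (u : U) (v : V) (x : X) :
  trot (u ⊗ v ⊗ x) = x ⊗ u ⊗ v.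
Proof. by rewrite /trot tflipE tassocE. Qed.

Lemma trotM (A B C : algType k) (s t : ((A ⊗ B) ⊗ C)%type) :
  trot (s * t) = trot s * trot t.
Proof. by rewrite /trot tflipM tassocM. Qed.

Lemma trot3 (U V X : lmodType k) (t : ((U ⊗ V) ⊗ X)%type) : trot (trot (trot t)) = t.
Proof. by move: t; apply: tensor3_ext => [x y|x y|u v x]; rewrite ?trotD ?trotE. Qed.

(** Two rotations invert one, and [trot] is [tassoc] after [tflip]; so they cancel [tassoc] and
    leave the flip. *)
Lemma trot2_tassoc (U V X : lmodType k) (t : (U ⊗ (V ⊗ X))%type) :
  trot (trot (tassoc t)) = tflip t.
Proof.
move: t; apply: tensor3_extr => [x y|x y|u v x]; rewrite ?(tassocD, trotD, tflipD) //.
by rewrite tassocE !trotE tflipE.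
Qed.

(** Writes (23) as (12) followed by two rotations, so the flip (12) and the rotation generate every
    permutation used below. *)
Lemma trot2_flip12_tassoc (U V X : lmodType k) (t : (U ⊗ (V ⊗ X))%type) :
  trot (trot (tmap (@tflip k U V) idfun (tassoc t))) = tassoc (tmap idfun (@tflip k V X) t).
Proof.
move: t; apply: tensor3_extr => [x y|x y|u v x]; rewrite ?(tmapD, tassocD, trotD) //.
by rewrite tassocE !tmapE /= !tflipE !trotE tassocE.
Qed.

End TripleTensors.

(** * Permutation actions on tensors over [H] *)

Section PseudoSymmetry.
Variables (k : fieldType) (H : hopfAlgType k).
Hypothesis comulC : cocommutative H.

Lemma tmap_flip_comul (X : lmodType k) (G : (H ⊗ X)%type) :
  tmap (@tflip k H H) idfun (tmap comul idfun G) = tmap comul idfun G.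
Proof.
move: G; apply: tensor_ext => [x y|x y|u v]; rewrite ?tmapD // !tmapE /=.
by rewrite comulC.
Qed.

(** The flip turns (Δ ⊗ id)Δ into (id ⊗ Δ)Δ by cocommutativity, and [tassoc] brings it back by
    coassociativity. This is what lets the rotation descend to [pten3 M]. *)
Lemma trot_comul3 (h : H) : trot (comul3 h) = comul3 h.
Proof. by rewrite /trot /comul3 tflip_tmap comulC comulA. Qed.

Section Actions.
Variable M : lmodType H.

Lemma psigmaD : {morph @psigma k H M : s t / s + t}.
Proof. by move=> s t; exact: (hliftD _ _ (psigma_balanced M comulC)). Qed.

Lemma psigmaZ F (t : pten2 M) : psigma (F *: t) = tflip F *: psigma t.
Proof.
move: t; apply: hten_ext => [s t|s t|G e].
- by rewrite scalerDr psigmaD.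
- by rewrite psigmaD scalerDr.
by rewrite scale_hmk !psigmaE // scale_hmk tflipM.
Qed.

Lemma psigmaK (t : pten2 M) : psigma (psigma t) = t.
Proof.
move: t; apply: hten_ext => [s t|s t|G e]; rewrite ?psigmaD //.
by rewrite !psigmaE // tflipK.
Qed.

Lemma pperm12D : {morph @pperm12 k H M : s t / s + t}.
Proof. by move=> s t; exact: (hliftD _ _ (pperm12_balanced M comulC)). Qed.

Lemma pperm12K (t : pten3 M) : pperm12 (pperm12 t) = t.
Proof.
move: t; apply: hten_ext => [s t|s t|G e]; rewrite ?pperm12D // !pperm12E //.
congr hmk; move: G; apply: tensor3_ext => [x y|x y|u v w]; rewrite ?tmapD //.
by rewrite !tmapE /= !tflipE.
Qed.

Definition prot (t : pten3 M) : pten3 M :=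
  hlift (fun F e => hmk (@comul3 k H) (trot F) e) t.

Lemma prot_balanced : hbalanced (@comul3 k H) (fun F (e : M) => hmk (@comul3 k H) (trot F) e).
Proof.
split=> [u u' v|u v v'|u h v]; first by rewrite trotD hmkDl.
  by rewrite hmkDr.
by rewrite trotM trot_comul3 hmkM.
Qed.

Lemma protE F (e : M) : prot (hmk (@comul3 k H) F e) = hmk (@comul3 k H) (trot F) e.
Proof. exact: (hlift_hmk _ _ prot_balanced). Qed.

Lemma protD : {morph prot : s t / s + t}.
Proof. by move=> s t; exact: (hliftD _ _ prot_balanced). Qed.

Lemma prot3 (t : pten3 M) : prot (prot (prot t)) = t.
Proof.
move: t; apply: hten_ext => [s t|s t|G e]; rewrite ?protD //.
by rewrite !protE trot3.
Qed.

End Actions.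

(** * Opposites and sums of pseudolinear operations *)

Section Compositions.
Variables L M N : lmodType H.
Implicit Type op : L -> M -> pten2 N.

(** The opposite operation. By conversion, [zinbiel_hat op a b] is
    [padd (op a b) (pop (op b a))]. *)
Definition pop op : M -> L -> pten2 N := fun y x => psigma (op x y).

Definition padd op op' : L -> M -> pten2 N := fun x y => op x y + op' x y.

Lemma padd_pseudolinear op op' :
  pseudolinear op -> pseudolinear op' -> pseudolinear (padd op op').
Proof.
move=> opP opP'; split=> [y c u v|x c u v|f g a b]; rewrite /padd.
- by rewrite (pseudo_linearl opP) (pseudo_linearl opP') scalerDr addrACA.
- by rewrite (pseudo_linearr opP) (pseudo_linearr opP') scalerDr addrACA.
- by rewrite (pseudoM opP) (pseudoM opP') scalerDr.
Qed.

Lemma pop_pseudolinear op : pseudolinear op -> pseudolinear (pop op).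
Proof.
move=> opP; split=> [y c u v|x c u v|f g a b]; rewrite /pop.
(* Scalars survive σ because the flip is linear and unital, hence fixes [c%:A]. *)
- by rewrite (pseudo_linearr opP) psigmaD psigmaZ linearZ rmorph1.
- by rewrite (pseudo_linearl opP) psigmaD psigmaZ linearZ rmorph1.
- by rewrite (pseudoM opP) psigmaZ tflipE.
Qed.

Lemma pcomplD op s t y : pseudolinear op ->
  pcompl op (s + t) y = pcompl op s y + pcompl op t y.
Proof. by move=> opP; exact: (hliftD _ _ (pcompl_balanced opP y)). Qed.

Lemma pcomprD op x s t : pseudolinear op ->
  pcompr op x (s + t) = pcompr op x s + pcompr op x t.
Proof. by move=> opP; exact: (hliftD _ _ (pcompr_balanced opP x)). Qed.

Lemma pcompl_padd op op' t y : pseudolinear op -> pseudolinear op' ->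
  pcompl (padd op op') t y = pcompl op t y + pcompl op' t y.
Proof.
move=> opP opP'; have addP := padd_pseudolinear opP opP'.
move: t; apply: hten_ext => [s t|s t|F x].
- exact: pcomplD.
- by rewrite !pcomplD // addrACA.
by rewrite !pcomplE // (hliftD _ _ (pcompl1_balanced _ _)).
Qed.

Lemma pcompr_padd op op' x t : pseudolinear op -> pseudolinear op' ->
  pcompr (padd op op') x t = pcompr op x t + pcompr op' x t.
Proof.
move=> opP opP'; have addP := padd_pseudolinear opP opP'.
move: t; apply: hten_ext => [s t|s t|F y].
- exact: pcomprD.
- by rewrite !pcomprD // addrACA.
by rewrite !pcomprE // (hliftD _ _ (pcompr1_balanced _ _)).
Qed.

End Compositions.

(** * How composition interacts with σ and with opposites *)

Section CompositionSymmetry.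
Variables (L M N : lmodType H) (op : L -> M -> pten2 N).
Hypothesis opP : pseudolinear op.
Let popP := pop_pseudolinear opP.

(** The factor (Δ ⊗ id)G is fixed by (12), so flipping F permutes the whole product. *)
Lemma pcompl_psigma t y : pcompl op (psigma t) y = pperm12 (pcompl op t y).
Proof.
move: t; apply: hten_ext => [s t|s t|F x].
- by rewrite psigmaD pcomplD.
- by rewrite pcomplD // pperm12D.
rewrite psigmaE // !pcomplE //; move: (op x y); apply: hten_ext => [s t|s t|G e].
- by rewrite (hliftD _ _ (pcompl1_balanced _ _)).
- by rewrite (hliftD _ _ (pcompl1_balanced _ _)) pperm12D.
rewrite !(hlift_hmk _ _ (pcompl1_balanced _ _)) pperm12E //.
by rewrite tmapM tmapE tmap_flip_comul.
Qed.

(** Mirror image of [pcompl_psigma]: (id ⊗ Δ)G is fixed by (23), which appears here as two rotations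
    after (12). *)
Lemma pcompr_psigma x t :
  pcompr op x (psigma t) = prot (prot (pperm12 (pcompr op x t))).
Proof.
move: t; apply: hten_ext => [s t|s t|F y].
- by rewrite psigmaD pcomprD.
- by rewrite pcomprD // pperm12D !protD.
rewrite psigmaE // !pcomprE //; move: (op x y); apply: hten_ext => [s t|s t|G e].
- by rewrite (hliftD _ _ (pcompr1_balanced _ _)).
- by rewrite (hliftD _ _ (pcompr1_balanced _ _)) pperm12D !protD.
rewrite !(hlift_hmk _ _ (pcompr1_balanced _ _)) pperm12E // !protE.
rewrite trot2_flip12_tassoc tmapM tmapE; congr (hmk _ (tassoc (_ * _)) _).
by move: G; apply: tensor_ext => [s t|s t|f g]; rewrite ?tmapD // !tmapE /= comulC.
Qed.

(** The outer flip carries (1 ⊗ F)(id ⊗ Δ)(G) to (F ⊗ 1)(Δ ⊗ id)(σG); after reassociation it becomes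
    a double rotation. *)
Lemma pcompl_pop t x : pcompl (pop op) t x = prot (prot (pcompr op x t)).
Proof.
move: t; apply: hten_ext => [s t|s t|F y].
- exact: pcomplD.
- by rewrite pcomprD // !protD.
rewrite pcomplE // pcomprE // /pop; move: (op x y).
apply: hten_ext => [s t|s t|G e].
- by rewrite psigmaD (hliftD _ _ (pcompl1_balanced _ _)).
- by rewrite (hliftD _ _ (pcompr1_balanced _ _)) !protD.
rewrite psigmaE // (hlift_hmk _ _ (pcompl1_balanced _ _)).
rewrite (hlift_hmk _ _ (pcompr1_balanced _ _)) !protE trot2_tassoc.
by rewrite tflipM tflipE tflip_tmap.
Qed.

Lemma pcompr_pop y t : pcompr (pop op) y t = prot (pcompl op t y).
Proof.
move: t; apply: hten_ext => [s t|s t|F x].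
- exact: pcomprD.
- by rewrite pcomplD // protD.
rewrite pcomplE // pcomprE // /pop; move: (op x y).
apply: hten_ext => [s t|s t|G e].
- by rewrite psigmaD (hliftD _ _ (pcompr1_balanced _ _)).
- by rewrite (hliftD _ _ (pcompl1_balanced _ _)) protD.
rewrite psigmaE // (hlift_hmk _ _ (pcompl1_balanced _ _)).
rewrite (hlift_hmk _ _ (pcompr1_balanced _ _)) protE /trot.
by rewrite tflipM tflipE tflip_tmap.
Qed.

End CompositionSymmetry.

Lemma zinbiel_hatC (Om : Type) (A : lmodType H) (op : Om -> Om -> A -> A -> pten2 A) :
  commutative_pseudo (zinbiel_hat op).
Proof. by move=> x y a b; rewrite /zinbiel_hat psigmaD psigmaK addrC. Qed.

(** * Associativity of the symmetrized product *)

Section Zinbiel.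
Variables (Om : Type) (mul : Om -> Om -> Om) (A : lmodType H).
Variable op : Om -> Om -> A -> A -> pten2 A.
Hypotheses (mulC : commutative mul) (opZ : zinbiel_pseudoalgebra mul op).

Let opP a b : pseudolinear (op a b). Proof. exact: zinbiel_pseudolinear opZ a b. Qed.

Lemma zinbiel_hatE x y z a b c :
  pcompl (op (mul a b) c) (zinbiel_hat op a b x y) z =
  pcompr (op a (mul b c)) x (op b c y z).
Proof. by rewrite pcomplD // pcompl_psigma // (zinbielE opZ). Qed.

(** Both sides are left compositions with a symmetrized product, which is commutative up to σ; σ on
    the left argument comes out as (12). Commutativity of [mul] matches the indices. *)
Lemma zinbiel_swap x y z a b c :
  pcompr (op a (mul b c)) x (op b c y z) =
  pperm12 (pcompr (op b (mul a c)) y (op a c x z)).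
Proof. by rewrite -!zinbiel_hatE (mulC b) -pcompl_psigma // -zinbiel_hatC. Qed.

Lemma zinbiel_hat_assoc : assoc_pseudoalgebra mul (zinbiel_hat op).
Proof.
split=> [a b|x y z a b c].
  exact: padd_pseudolinear (opP a b) (pop_pseudolinear (opP b a)).
(* The two summands are given explicitly, since [zinbiel_hat] is a [padd] only up to conversion. *)
rewrite (@pcompl_padd _ _ _ (op (mul a b) c) (pop (op c (mul a b)))) //; last first.
  exact: pop_pseudolinear.
rewrite (@pcompr_padd _ _ _ (op a (mul b c)) (pop (op (mul b c) a))) //; last first.
  exact: pop_pseudolinear.
rewrite zinbiel_hatE pcompl_pop // pcompr_pop // zinbiel_hatE.
(* Both sides now contain x * (y * z); two terms remain on each. *)
rewrite {1 2}/zinbiel_hat !pcomprD // -addrA; congr (_ + _).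
rewrite !protD; congr (_ + _).
  (* Two rotations of z * (x * y) match x * σ(z * y). *)
  by rewrite zinbiel_swap (mulC c) pcompr_psigma.
(* The σ and the swap each contribute a (12), which cancel; four rotations of y * (z * x) are left,
   that is, one. *)
rewrite (mulC a) pcompr_psigma // zinbiel_swap pperm12K.
by rewrite prot3.
Qed.

End Zinbiel.

End PseudoSymmetry.

Theorem proposition3p28 (k : closedFieldType) (char_k : [pchar k] =i pred0)
    (H : hopfAlgType k) (comulC : cocommutative H)
    (Om : Type) (mul : SemiGroup.com_law Om)
    (A : lmodType H) (op : Om -> Om -> A -> A -> pten2 A)
    (op_zinbiel : zinbiel_pseudoalgebra mul op) :
  assoc_pseudoalgebra mul (zinbiel_hat op) /\ commutative_pseudo (zinbiel_hat op).
Proof.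
split; last exact: zinbiel_hatC.
exact: (zinbiel_hat_assoc comulC (@SemiGroup.opC _ mul)).
Qed.
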